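(* For every prime $p$, the number $mq(\mathbb{Z}_p^2)$ of isomorphism classes of medial quasigroups that admit an affine form over the group $\mathbb{Z}_p^2=\mathbb{Z}_p\times\mathbb{Z}_p$ is $$mq(\mathbb{Z}_p^2)=p^4-p^2-p-1.$$
   Context: A quasigroup is a set $Q$ with a binary operation $*$ such that for all $a,b\in Q$ the equations $a*x=b$ and $y*a=b$ have unique solutions $x,y\in Q$. A quasigroup $(Q,* )$ is medial if $(x*y)*(u*v)=(x*u)*(y*v)$ for all $x,y,u,v\in Q$. Given an abelian group $G=(G,+)$, automorphisms $\varphi,\psi$ of $G$, and an element $c\in G$, let $\mathcal{Q}(G,+,\varphi,\psi,c)$ denote the quasigroup $(G,* )$ with $x*y=\varphi(x)+\psi(y)+c$. A quasigroup admits an affine form over $G$ if it is isomorphic to $\mathcal{Q}(G,+,\varphi,\psi,c)$ for some automorphisms $\varphi,\psi$ of $G$ and some $c\in G$. For a finite abelian group $G$, $mq(G)$ denotes the number of medial quasigroups that admit an affine form over $G$, counted up to isomorphism of quasigroups. $\mathbb{Z}_n$ denotes the cyclic group of order $n$. *)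

(* Defs.v *)
From HB Require Import structures.
From mathcomp Require Import all_boot all_order all_algebra.
From mathcomp Require Import boolp.

Set Implicit Arguments.
Unset Strict Implicit.
Unset Printing Implicit Defensive.

Import GRing.Theory.
Local Open Scope ring_scope.

(* Joins the existing Finite and Zmodule instances of A * B into finZmodType. *)
HB.saturate prod.

Definition quasigroup (Q : Type) (op : Q -> Q -> Q) : Prop :=
  forall a b : Q, (exists! x, op a x = b) /\ (exists! y, op y a = b).

Definition medial (Q : Type) (op : Q -> Q -> Q) : Prop :=
  forall x y u v : Q, op (op x y) (op u v) = op (op x u) (op y v).

Definition medial_quasigroup (Q : Type) (op : Q -> Q -> Q) : Prop :=
  quasigroup op /\ medial op.

Definition isomorphic (Q1 Q2 : Type)
    (op1 : Q1 -> Q1 -> Q1) (op2 : Q2 -> Q2 -> Q2) : Prop :=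
  exists f : Q1 -> Q2,
    bijective f /\ forall x y : Q1, f (op1 x y) = op2 (f x) (f y).

Definition affine_op (G : zmodType) (phi psi : G -> G) (c x y : G) : G :=
  phi x + psi y + c.

Definition admits_affine_form (G : zmodType) (Q : Type)
    (op : Q -> Q -> Q) : Prop :=
  exists (phi psi : {additive G -> G}) (c : G),
    [/\ bijective phi, bijective psi & isomorphic op (affine_op phi psi c)].

Lemma isomorphic_refl (Q : Type) (op : Q -> Q -> Q) : isomorphic op op.
Proof. by exists id; split=> //; exists id. Qed.

Lemma isomorphic_sym (Q1 Q2 : Type)
    (op1 : Q1 -> Q1 -> Q1) (op2 : Q2 -> Q2 -> Q2) :
  isomorphic op1 op2 -> isomorphic op2 op1.
Proof.
move=> [f [[g fK gK] fM]]; exists g; split; first by exists f.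
by move=> x y; rewrite -{1}(gK x) -{1}(gK y) -fM fK.
Qed.

Lemma isomorphic_trans (Q1 Q2 Q3 : Type) (op1 : Q1 -> Q1 -> Q1)
    (op2 : Q2 -> Q2 -> Q2) (op3 : Q3 -> Q3 -> Q3) :
  isomorphic op1 op2 -> isomorphic op2 op3 -> isomorphic op1 op3.
Proof.
move=> [f [bf fM]] [g [bg gM]]; exists (g \o f); split; first exact: bij_comp.
by move=> x y /=; rewrite fM gM.
Qed.

(* Binary operations on the carrier of G, as a finite type. *)
Definition binop (G : finType) := {ffun G * G -> G}.

Definition binop_fun (G : finType) (t : binop G) (x y : G) : G := t (x, y).

(* Operations on the carrier of G suffice for counting isomorphism classes:
   see [admits_affine_form_carrier] below. *)
Definition mq_set (G : finZmodType) : {set binop G} :=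
  [set t : binop G | `[< medial_quasigroup (binop_fun t) >]
                     && `[< admits_affine_form G (binop_fun t) >]].

Definition mq (G : finZmodType) : nat :=
  #|equivalence_partition
      (fun s t : binop G => `[< isomorphic (binop_fun s) (binop_fun t) >])
      (mq_set G)|.

Lemma medial_quasigroup_iso (Q1 Q2 : Type)
    (op1 : Q1 -> Q1 -> Q1) (op2 : Q2 -> Q2 -> Q2) :
  isomorphic op1 op2 -> medial_quasigroup op1 -> medial_quasigroup op2.
Proof.
move=> iso12 [q1 m1]; have [g [[f gK fK] gM]] := isomorphic_sym iso12.
split=> [a b|x y u v]; last by apply: (can_inj gK); rewrite !gM m1.
have [[x [xP xU]] [y [yP yU]]] := q1 (g a) (g b).
split; [exists (f x)|exists (f y)]; split=> [|z zP].
- by apply: (can_inj gK); rewrite gM fK.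
- by rewrite (xU (g z)) ?gK // -gM zP.
- by apply: (can_inj gK); rewrite gM fK.
- by rewrite (yU (g z)) ?gK // -gM zP.
Qed.

Lemma admits_affine_form_carrier (G : finZmodType) (Q : Type)
    (op : Q -> Q -> Q) :
  medial_quasigroup op -> admits_affine_form G op ->
  exists2 t : binop G, t \in mq_set G & isomorphic op (binop_fun t).
Proof.
move=> mop [phi [psi [c [bphi bpsi iso]]]].
pose t : binop G := [ffun xy => affine_op phi psi c xy.1 xy.2].
have tE : binop_fun t = affine_op phi psi c.
  by apply: funext => x; apply: funext => y; rewrite /binop_fun ffunE.
exists t; rewrite ?tE // inE tE; apply/andP; split; apply/asboolP.
  exact: medial_quasigroup_iso iso mop.
by exists phi, psi, c; split=> //; apply: isomorphic_refl.
Qed.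

(* Main.v *)
(** The idea is to list normal forms. An isomorphism between two quasigroups
    affine over G is an affine map of G, and additive maps of F_p^2 are linear,
    so one has to classify triples (phi, psi, c) with phi and psi commuting,
    up to linear conjugation and up to c ~ c + (1 - phi - psi) t.
    If phi is not scalar, it has a cyclic vector, which identifies F_p^2 with
    A = F_p[X]/(X^2 - T X + m), phi with multiplication by X, and psi with
    multiplication by some be in A; T, m and be are invariants. If phi is
    scalar and psi is not, the roles are exchanged. Otherwise both are scalar.
    What remains is c, an element of A/dA with d = 1 - phi - psi, up to units
    of A: it can be made 0; or 1 when d is not a unit; or, when d = 0, X - s
    with s a root of X^2 - T X + m. The normal forms are then counted with T
    and m expressed, where needed, through the roots of X^2 - T X + m. *)

From HB Require Import structures.
Require Import Defs.
From mathcomp Require Import all_boot all_order all_algebra.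
From mathcomp Require Import boolp ring.

Set Implicit Arguments.
Unset Strict Implicit.
Unset Printing Implicit Defensive.

Import GRing.Theory.
Local Open Scope ring_scope.

(** * Counting equivalence classes by a transversal *)

Lemma card_equivalence_partition (T I : finType) (R : rel T) (S : {set T})
    (D : {set I}) (f : I -> T) :
    equivalence_rel R -> {in D, forall i, f i \in S} ->
    {in D &, forall i j, R (f i) (f j) -> i = j} ->
    {in S, forall x, exists2 i, i \in D & R x (f i)} ->
  #|equivalence_partition R S| = #|D|.
Proof.
move=> eqR fS fI fR; pose g i := [set y in S | R (f i) y].
have Rrefl x : R x x by have [] := eqR x x x.
have Rtr x y z : R x y -> R x z = R y z by have [_] := eqR x y z.
have -> : equivalence_partition R S = g @: D.
  apply/setP => X; apply/imsetP/imsetP => -[].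
    move=> x xS ->; have [i iD Rxi] := fR x xS; exists i => //.
    by apply/setP => y; rewrite !inE (Rtr _ _ _ Rxi).
  by move=> i iD ->; exists (f i) => //; apply: fS.
rewrite card_in_imset // => i j iD jD /setP/(_ (f j)).
by rewrite !inE fS // Rrefl /= => /fI; apply.
Qed.

(** * Affine quasigroups over an abelian group and their isomorphisms *)

Section Affine.
Variable G : zmodType.
Implicit Types (phi psi : {additive G -> G}) (c : G).

Lemma medial_affine_op phi psi c :
  medial (affine_op phi psi c) -> forall x, phi (psi x) = psi (phi x).
Proof.
move=> med x; have := med 0 x 0 0.
rewrite /affine_op !(raddfD, raddf0) !(addr0, add0r) !addrA.
by move=> /addIr/addIr; rewrite [LHS]addrC => /addrI.
Qed.

Lemma affine_op_quasigroup phi psi c :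
  bijective phi -> bijective psi -> quasigroup (affine_op phi psi c).
Proof.
move=> [phi' phiK phi'K] [psi' psiK psi'K] a b; rewrite /affine_op; split.
  exists (psi' (b - c - phi a)); split=> [|x <-].
    by rewrite psi'K [phi a + _]addrC !subrK.
  by rewrite addrK [phi a + _]addrC addrK psiK.
exists (phi' (b - c - psi a)); split=> [|x <-].
  by rewrite phi'K !subrK.
by rewrite !addrK phiK.
Qed.

(** At preimages under [phi] and [psi], the homomorphism law becomes [f (u + v + c) + f c = f (u +
    c) + f (v + c)], so [f] is additive up to a translation. The law at [(x, 0)], [(0, x)] and
    [(0, 0)] then gives the other identities. *)
Lemma affine_op_isomorphism phi psi c phi' psi' c' (f : G -> G) :
    bijective phi -> bijective psi ->
    (forall x y, f (affine_op phi psi c x y) =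
                 affine_op phi' psi' c' (f x) (f y)) ->
  exists g : {additive G -> G},
    [/\ forall x, f x = g x + f 0, forall x, g (phi x) = phi' (g x),
        forall x, g (psi x) = psi' (g x)
      & g c + f 0 = phi' (f 0) + psi' (f 0) + c'].
Proof.
move=> [phii _ phiK] [psii _ psiK] fM.
have fD u v : f (u + v + c) + f c = f (u + c) + f (v + c).
  have e w : phi (phii w) + psi 0 + c = w + c by rewrite phiK raddf0 addr0.
  have e' w : phi 0 + psi (psii w) + c = w + c by rewrite psiK raddf0 add0r.
  have := (fM (phii u) (psii v), fM 0 0, fM (phii u) 0, fM 0 (psii v)).
  rewrite /affine_op !e !e' phiK psiK !raddf0 !add0r => -[[[-> ->] ->] ->].
  rewrite addrACA [RHS]addrACA; congr (_ + _); rewrite addrACA [RHS]addrACA.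
  by congr (_ + _); rewrite addrC.
pose h u := f (u + c) - f c.
have hD : nmod_morphism h.
  split=> [|u v]; rewrite /h; first by rewrite add0r subrr.
  by rewrite addrACA -fD addrA addrK.
have [g gE] : exists g : {additive G -> G}, forall x, g x = h x.
  pose g : {additive G -> G} := HB.pack h (GRing.isNmodMorphism.Build G G h hD).
  by exists g.
have fE x : f x = g (x - c) + f c by rewrite gE /h !subrK.
have f0 x : f x = g x + f 0.
  by rewrite (fE x) (fE 0) addrA -raddfD sub0r.
exists g; split=> [//|x|x|]; last 1 first.
- by rewrite -f0; have := fM 0 0; rewrite /affine_op !raddf0 !add0r.
- have := fM x 0; have := fM 0 0; rewrite /affine_op !raddf0 !(addr0, add0r).
  rewrite f0 [f (phi x + c)]f0 [f x]f0 !raddfD -!addrA => ->.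
  by move/addIr.
- have := fM 0 x; have := fM 0 0; rewrite /affine_op !raddf0 !(addr0, add0r).
  rewrite f0 [f (psi x + c)]f0 [f x]f0 !raddfD -!addrA => ->.
  by rewrite addrCA => /addrI/addIr.
Qed.
End Affine.

(** * Arithmetic of quadratic algebras over a field *)

Section QuadraticAlgebra.
Variable F : fieldType.
Implicit Types (T m k : F) (x y z t u : F * F).

(* The pair (a, b) stands for a + b X in F[X]/(X^2 - T X + m). *)
Definition qmul T m x y : F * F :=
  (x.1 * y.1 - m * x.2 * y.2, x.1 * y.2 + x.2 * y.1 + T * x.2 * y.2).

(** The product of [a + b X] with its conjugate [a + b (T - X)]; it is nonzero exactly on the
    units. *)
Definition qnorm T m x : F := x.1 ^+ 2 + T * x.1 * x.2 + m * x.2 ^+ 2.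

Definition pscale k x : F * F := (k * x.1, k * x.2).

Lemma qmulC T m x y : qmul T m x y = qmul T m y x.
Proof. by apply: injective_projections => /=; ring. Qed.

Lemma qmulA T m x y z : qmul T m x (qmul T m y z) = qmul T m (qmul T m x y) z.
Proof. by apply: injective_projections => /=; ring. Qed.

Lemma qmulCA T m x y z : qmul T m x (qmul T m y z) = qmul T m y (qmul T m x z).
Proof. by apply: injective_projections => /=; ring. Qed.

Lemma qmul1 T m x : qmul T m x (1, 0) = x.
Proof. by apply: injective_projections => /=; ring. Qed.

Lemma qmul_scalar T m k x : qmul T m (k, 0) x = pscale k x.
Proof. by apply: injective_projections => /=; ring. Qed.

Lemma qmul_zmod_morphism T m x : zmod_morphism (qmul T m x).
Proof. by move=> y z; apply: injective_projections => /=; ring. Qed.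

HB.instance Definition _ T m x :=
  GRing.isZmodMorphism.Build (F * F)%type (F * F)%type (qmul T m x)
    (qmul_zmod_morphism T m x).

Lemma qnormM T m x y : qnorm T m (qmul T m x y) = qnorm T m x * qnorm T m y.
Proof. by rewrite /qnorm /=; ring. Qed.

Lemma qmul_inv T m x :
  qnorm T m x != 0 -> exists2 y, qmul T m x y = (1, 0) & qnorm T m y != 0.
Proof.
(* [y] is the conjugate of [x] divided by the norm. *)
move=> Nx; pose y := ((x.1 + T * x.2) / qnorm T m x, - x.2 / qnorm T m x).
have xy : qmul T m x y = (1, 0).
  by apply: injective_projections; rewrite /y /=; move: Nx;
    rewrite /qnorm => Nx;
    field.
exists y => //; apply/eqP => Ny; have := qnormM T m x y.
rewrite xy Ny mulr0 /qnorm /= => /eqP.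
by rewrite expr1n mulr0 expr0n /= !mulr0 !addr0 oner_eq0.
Qed.

Lemma qmul_bij T m x : qnorm T m x != 0 -> bijective (qmul T m x).
Proof.
move=> /qmul_inv[y xy _]; exists (qmul T m y) => z; rewrite qmulA.
  by rewrite [qmul _ _ y x]qmulC xy qmulC qmul1.
by rewrite xy qmulC qmul1.
Qed.

(** If the norm were zero, [x] would annihilate its conjugate; the conjugate would then be zero,
    hence [x] as well, and [x] would annihilate 1. *)
Lemma qnorm_neq0 T m x :
  (forall y, qmul T m x y = 0 -> y = 0) -> qnorm T m x != 0.
Proof.
move=> injx; apply/eqP => Nx.
have [x1 x2] : (x.1 + T * x.2, - x.2) = 0 :> F * F.
  apply: injx; apply: injective_projections => /=; last by ring.
  by rewrite -[RHS]Nx /qnorm; ring.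
have /injx[/eqP] : qmul T m x (1, 0) = 0; last by rewrite oner_eq0.
move: x2 x1 => /eqP; rewrite oppr_eq0 qmul1 => /eqP x2.
by rewrite x2 mulr0 addr0 => x1; apply: injective_projections.
Qed.

Definition qop T m al be c := affine_op (qmul T m al) (qmul T m be) c.

Lemma qop_medial_quasigroup T m al be c :
  qnorm T m al != 0 -> qnorm T m be != 0 ->
  medial_quasigroup (qop T m al be c).
Proof.
move=> Nal Nbe; split; first by apply: affine_op_quasigroup; apply: qmul_bij.
by move=> x y u v; rewrite /qop /affine_op; apply: injective_projections => /=;
  ring.
Qed.

Lemma qop_admits_affine_form T m al be c :
  qnorm T m al != 0 -> qnorm T m be != 0 ->
  admits_affine_form (F * F)%type (qop T m al be c).
Proof.
move=> Nal Nbe; exists (qmul T m al), (qmul T m be), c.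
by split; [apply: qmul_bij|apply: qmul_bij|apply: isomorphic_refl].
Qed.

End QuadraticAlgebra.

(** * Normal forms and normalization of the constant *)

Section Classification.
Variable F : fieldType.
Implicit Types (T m k : F) (x y z t u al be c d e : F * F).

(** When [al] and [be] are both scalars, the operation does not depend on [T] and [m], which are
    therefore fixed to 0. The last alternative for [c] is [X - s] with [s] a root. It arises only
    for [al = X]: [d] is nonzero when [al] is scalar and [be = X], and for two scalars with [d = 0]
    a linear automorphism moves any nonzero [c] to 1. *)
Definition qnormal T m al be c : Prop :=
  let d := (1, 0) - al - be in
  [/\ qnorm T m al != 0, qnorm T m be != 0,
      [\/ al = (0, 1), al.2 = 0 /\ be = (0, 1)
        | [/\ al.2 = 0, be.2 = 0, T = 0 & m = 0]]
    & [\/ c = 0, c = (1, 0) /\ qnorm T m d = 0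
        | [/\ al = (0, 1), d = 0, c.2 = 1 & qnorm T m c = 0]]].

Lemma qop_translate T m al be c u t :
    qnorm T m u != 0 ->
  isomorphic (qop T m al be c)
    (qop T m al be (qmul T m u c + qmul T m ((1, 0) - al - be) t)).
Proof.
move=> Nu; exists (fun x => qmul T m u x + t); split.
  have [v uv vu] := qmul_bij Nu.
  by exists (fun x => v (x - t)) => x; rewrite ?addrK ?vu ?subrK ?uv.
move=> x y; rewrite /qop /affine_op.
by apply: injective_projections => /=; ring.
Qed.

(** A unit [d] absorbs [c] entirely. If [d = 0], only multiplication by [u] acts: a unit [c] becomes
    1, and a nonzero non-unit is scaled to be monic in X. If [d] is a nonzero non-unit, its
    multiples form the line spanned by [d], and scalars suffice for [u] and [t]. *)
Lemma normalize_constant T m d c :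
  exists2 u, qnorm T m u != 0 &
    exists t, let c' := qmul T m u c + qmul T m d t in
    [\/ c' = 0, c' = (1, 0) /\ qnorm T m d = 0
      | [/\ d = 0, c'.2 = 1 & qnorm T m c' = 0]].
Proof.
have N1 : qnorm T m (1, 0) != 0.
  by rewrite /qnorm /= mulr0 expr0n /= !mulr0 !addr0 expr1n oner_eq0.
have NZ k : k != 0 -> qnorm T m (k, 0) != 0.
  by move=> k0; rewrite /qnorm /= mulr0 expr0n /= !mulr0 !addr0 expf_eq0.
have [Nd|Nd] := eqVneq (qnorm T m d) 0; last first.
  have [v dv _] := qmul_inv Nd; exists (1, 0) => //.
  exists (- qmul T m v c) => /=; constructor 1.
  by rewrite raddfN /= qmulA dv qmulC subrr.
have [d0|d0] := eqVneq d 0.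
  rewrite d0; have E u t : qmul T m u c + qmul T m 0 t = qmul T m u c.
    by apply: injective_projections => /=; ring.
  have [Nc|Nc] := eqVneq (qnorm T m c) 0; last first.
    have [v cv Nv] := qmul_inv Nc; exists v => //; exists 0 => /=.
    rewrite E qmulC cv; constructor 2; split=> //.
    by rewrite /qnorm /=; ring.
  have [c2|c2] := eqVneq c.2 0.
    exists (1, 0) => //; exists 0 => /=; rewrite E qmulC qmul1; constructor 1.
    apply: injective_projections => //; apply/eqP; move: Nc.
    by rewrite /qnorm c2 expr0n /= !mulr0 !addr0 => /eqP; rewrite expf_eq0.
  exists (c.2^-1, 0); first by rewrite NZ ?invr_eq0.
  exists 0 => /=; rewrite E; constructor 3; split=> //.
    by rewrite /=; field.
  by rewrite qnormM Nc mulr0.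
have d2 : d.2 != 0.
  apply: contraNneq d0 => d2; apply/eqP; apply: injective_projections => //.
  apply/eqP; move: Nd.
  by rewrite /qnorm d2 expr0n /= !mulr0 !addr0 => /eqP; rewrite expf_eq0.
(* Modulo scalar multiples of [d], the constant [c] equals the scalar [l]. *)
pose l := c.1 - c.2 * d.1 / d.2.
have [l0|l0] := eqVneq l 0.
  exists (1, 0) => //; exists (- c.2 / d.2, 0) => /=; constructor 1.
  apply: injective_projections => /=; last by field.
  by rewrite -[RHS]l0 /l; field.
exists (l^-1, 0); first by rewrite NZ ?invr_eq0.
exists (- c.2 / d.2 / l, 0) => /=; constructor 2; split=> //.
have E : c.1 * d.2 - c.2 * d.1 != 0.
  by apply: contraNneq l0 => E; rewrite /l -(mulfK d2 c.1) -mulrBl E mul0r.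
by apply: injective_projections; rewrite /l /=; field; apply/andP.
Qed.

(** * Existence of normal forms, through cyclic vectors *)

Definition pdet x y : F := x.1 * y.2 - x.2 * y.1.

Definition pcomb e e' x : F * F := pscale x.1 e + pscale x.2 e'.

Lemma pcomb_zmod_morphism e e' : zmod_morphism (pcomb e e').
Proof. by move=> x y; apply: injective_projections => /=; ring. Qed.

HB.instance Definition _ e e' :=
  GRing.isZmodMorphism.Build (F * F)%type (F * F)%type (pcomb e e')
    (pcomb_zmod_morphism e e').

Lemma pcomb_bij e e' : pdet e e' != 0 -> bijective (pcomb e e').
Proof.
move=> de; exists (fun x => (pdet x e' / pdet e e', pdet e x / pdet e e')) => x;
  by apply: injective_projections; move: de; rewrite /pdet /= => de; field.
Qed.

Definition plinear (f : F * F -> F * F) :=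
  forall k x, f (pscale k x) = pscale k (f x).

(** If none of [(1, 0)], [(0, 1)], [(1, 1)] is cyclic, the matrix of [f] is diagonal with equal
    diagonal entries. *)
Lemma cyclic_or_scalar (f : {additive (F * F)%type -> (F * F)%type}) :
  plinear f ->
  (exists e, pdet e (f e) != 0) \/ (exists k, forall x, f x = pscale k x).
Proof.
move=> fZ; have [f1|f1] := eqVneq (f (1, 0)).2 0; last first.
  by left; exists (1, 0); rewrite /pdet /= mul1r mul0r subr0.
have [f2|f2] := eqVneq (f (0, 1)).1 0; last first.
  by left; exists (0, 1); rewrite /pdet /= mul1r mul0r sub0r oppr_eq0.
have [f3|f3] := eqVneq (f (0, 1)).2 (f (1, 0)).1; last first.
  left; exists (1, 1); have -> : (1, 1) = (1, 0) + (0, 1) :> F * F.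
    by apply: injective_projections; rewrite /= ?addr0 ?add0r.
  by rewrite raddfD /pdet /= f1 f2 !addr0 !add0r !mul1r subr_eq0.
right; exists (f (1, 0)).1 => x.
have -> : x = pscale x.1 (1, 0) + pscale x.2 (0, 1).
  by apply: injective_projections => /=; ring.
rewrite raddfD !fZ; apply: injective_projections => /=.
  by rewrite f2; ring.
by rewrite f1 f3; ring.
Qed.

(** In the basis [e], [f e] the map [f] becomes multiplication by X. A linear map commuting with [f]
    is determined by its value at [e], so it becomes multiplication by the coordinates of that
    value. The cases [f = phi] and [f = psi] are both used. *)
Lemma cyclic_form (phi psi f : {additive (F * F)%type -> (F * F)%type}) c e :
    plinear phi -> plinear psi -> plinear f ->
    bijective phi -> bijective psi -> pdet e (f e) != 0 ->
    (forall x, phi (f x) = f (phi x)) -> (forall x, psi (f x) = f (psi x)) ->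
  exists T m al be c', [/\ isomorphic (affine_op phi psi c) (qop T m al be c'),
    qnorm T m al != 0, qnorm T m be != 0,
    phi e = pcomb e (f e) al & psi e = pcomb e (f e) be].
Proof.
move=> phiZ psiZ fZ phib psib de phif psif.
have [B' BK B'K] := pcomb_bij de; set B := pcomb e (f e) in BK B'K *.
(* The coordinates of [f (f e)] provide [T] and [m], so that [f (f e) = T f e - m e] mirrors
   [X^2 = T X - m]. *)
have [w fw] : exists w, f (f e) = B w by exists (B' (f (f e))).
pose T := w.2; pose m := - w.1.
have BM (g : {additive (F * F)%type -> (F * F)%type}) x : plinear g ->
    (forall x, g (f x) = f (g x)) -> g (B x) = B (qmul T m (B' (g e)) x).
  move=> gZ gf; rewrite /B /pcomb raddfD !gZ gf.
  have [v ge] : exists v, g e = B v by exists (B' (g e)).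
  rewrite ge BK {1}/B /pcomb raddfD !fZ fw /B /pcomb /m /T.
  by apply: injective_projections => /=; ring.
have NB (g : {additive (F * F)%type -> (F * F)%type}) : plinear g ->
    (forall x, g (f x) = f (g x)) -> bijective g -> qnorm T m (B' (g e)) != 0.
  move=> gZ gf /bij_inj gI; apply: qnorm_neq0 => y y0.
  by apply: (can_inj BK); apply: gI; rewrite BM // y0 /B !raddf0.
exists T, m, (B' (phi e)), (B' (psi e)), (B' c).
split; [|exact: NB|exact: NB|by rewrite -[LHS]B'K|by rewrite -[LHS]B'K].
apply: isomorphic_sym; exists B; split; first by exists B'.
move=> x y; rewrite /qop /affine_op !BM // /B !raddfD.
by congr (_ + _); apply: B'K.
Qed.

Lemma affine_op_qnormal (phi psi : {additive (F * F)%type -> (F * F)%type}) c :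
    plinear phi -> plinear psi -> bijective phi -> bijective psi ->
    (forall x, phi (psi x) = psi (phi x)) ->
  exists T m al be c', qnormal T m al be c' /\
    isomorphic (affine_op phi psi c) (qop T m al be c').
Proof.
move=> phiZ psiZ phib psib comm.
have [[e de]|[k phik]] := cyclic_or_scalar phiZ.
  have [|T [m [al [be [c1 [iso Nal Nbe phie _]]]]]] :=
    cyclic_form c phiZ psiZ phiZ phib psib de (fun=> erefl).
    by move=> x; rewrite comm.
  have [u Nu [t ct]] := normalize_constant T m ((1, 0) - al - be) c1.
  exists T, m, al, be, (qmul T m u c1 + qmul T m ((1, 0) - al - be) t).
  split; last exact: isomorphic_trans iso (qop_translate _ _ _ _ Nu).
  have al1 : al = (0, 1).
    apply: (bij_inj (pcomb_bij de)); rewrite -phie.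
    by apply: injective_projections => /=; ring.
  split=> //; first by constructor 1.
  by case: ct => [|[]|[]] *; [constructor 1|constructor 2|constructor 3].
have k0 : k != 0.
  apply/eqP => k0; have /(bij_inj phib)[/eqP] : phi (1, 0) = phi 0.
    by rewrite !phik k0; apply: injective_projections => /=; ring.
  by rewrite oner_eq0.
have [[e de]|[l psil]] := cyclic_or_scalar psiZ.
  have [T [m [al [be [c1 [iso Nal Nbe phie psie]]]]]] :=
    cyclic_form c phiZ psiZ psiZ phib psib de comm (fun=> erefl).
  have [u Nu [t ct]] := normalize_constant T m ((1, 0) - al - be) c1.
  exists T, m, al, be, (qmul T m u c1 + qmul T m ((1, 0) - al - be) t).
  split; last exact: isomorphic_trans iso (qop_translate _ _ _ _ Nu).
  have al1 : al = (k, 0).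
    apply: (bij_inj (pcomb_bij de)); rewrite -phie phik.
    by apply: injective_projections => /=; ring.
  have be1 : be = (0, 1).
    apply: (bij_inj (pcomb_bij de)); rewrite -psie.
    by apply: injective_projections => /=; ring.
  split=> //; first by constructor 2; rewrite al1.
  (* The root alternative would need [d = 0], but the second coordinate of [d] is -1 here. *)
  case: ct => [|[]|[d0]] *; [by constructor 1|by constructor 2|].
  have /eqP := congr1 snd d0; rewrite al1 be1 /= subr0 sub0r oppr_eq0.
  by rewrite oner_eq0.
have l0 : l != 0.
  apply/eqP => l0; have /(bij_inj psib)[/eqP] : psi (1, 0) = psi 0.
    by rewrite !psil l0; apply: injective_projections => /=; ring.
  by rewrite oner_eq0.
have opE T m c' : affine_op phi psi c' = qop T m (k, 0) (l, 0) c'.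
  apply: funext => x; apply: funext => y.
  by rewrite /qop /affine_op !qmul_scalar phik psil.
(* The operation does not depend on T and m here, so that c may be made a
   unit. *)
have [m Nc] : exists m, c != 0 -> qnorm 0 m c != 0.
  have [c2|c2] := eqVneq c.2 0.
    exists 0; apply: contraNneq; rewrite /qnorm c2 mul0r !mulr0 !mul0r !addr0.
    move/eqP; rewrite expf_eq0 /= => /eqP c1; apply/eqP.
    exact: injective_projections.
  exists ((1 - c.1 ^+ 2) / c.2 ^+ 2) => _.
  suff -> : qnorm 0 ((1 - c.1 ^+ 2) / c.2 ^+ 2) c = 1 by rewrite oner_eq0.
  by rewrite /qnorm; field.
have NZ m' k' : qnorm 0 m' (k', 0) = k' ^+ 2 by rewrite /qnorm /=; ring.
have dE : (1, 0) - (k, 0) - (l, 0) = (1 - k - l, 0) :> F * F.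
  by apply: injective_projections; rewrite /= ?subr0.
have [u Nu [t ct]] := normalize_constant 0 m ((1, 0) - (k, 0) - (l, 0)) c.
have iso := qop_translate (k, 0) (l, 0) c t Nu.
move: iso ct; set c' := qmul _ _ u c + _ => iso ct.
exists 0, 0, (k, 0), (l, 0), c'; split; last first.
  by rewrite -(opE 0 0) (opE 0 m) (opE 0 m).
split; rewrite ?NZ ?expf_eq0 //; first by constructor 3.
move: ct; rewrite dE !NZ => -[|[]|[d0 c'2 Nc']].
- by constructor 1.
- by constructor 2.
(* By the choice of [m], a zero norm with [d = 0] forces [c = 0]. *)
move: Nc' c'2; rewrite /c' dE d0.
have -> : qmul 0 m 0 t = 0 by apply: injective_projections => /=; ring.
rewrite addr0 qnormM => /eqP; rewrite mulf_eq0 (negPf Nu) /= => Nc0.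
have [->|c0] := eqVneq c 0; last by rewrite (negPf (Nc c0)) in Nc0.
by constructor 1; apply: raddf0.
Qed.

(** * Uniqueness of normal forms *)

Section Isomorphism.
Variables (T m T' m' : F) (g : {additive (F * F)%type -> (F * F)%type}).
Hypotheses (gZ : plinear g) (gb : bijective g).

(** Multiplication by a scalar commutes with the linear bijection [g], so conjugation by [g] leaves
    it unchanged. *)
Lemma intertwine_scalar al al' :
    (forall x, g (qmul T m al x) = qmul T' m' al' (g x)) ->
  al.2 = 0 \/ al'.2 = 0 -> al = al'.
Proof.
case: gb => h gK hK gM [al2|al2].
  have := gM (h (1, 0)); rewrite hK qmul1 => <-.
  have -> : qmul T m al (h (1, 0)) = pscale al.1 (h (1, 0)).
    by apply: injective_projections; rewrite /= al2; ring.
  by rewrite gZ hK; apply: injective_projections; rewrite /= ?al2; ring.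
rewrite -[LHS](qmul1 T m); apply: (can_inj gK); rewrite gM.
have -> : qmul T' m' al' (g (1, 0)) = pscale al'.1 (g (1, 0)).
  by apply: injective_projections; rewrite /= al2; ring.
rewrite -gZ; congr (g _).
by apply: injective_projections; rewrite /= ?al2; ring.
Qed.

(** Linearity and the intertwining of the two generators determine [g] from [u = g (1, 0)].
    Evaluating [g] at the square of the generator, with coordinates [(- m, T)], and using
    injectivity identifies [T] and [m]. *)
Lemma intertwine_generator :
    (forall x, g (qmul T m (0, 1) x) = qmul T' m' (0, 1) (g x)) ->
  [/\ T = T', m = m' & forall x, g x = qmul T m (g (1, 0)) x].
Proof.
have gI := bij_inj gb; move=> gX; set u := g (1, 0).
have gXu : g (0, 1) = qmul T' m' (0, 1) u by rewrite -gX qmul1.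
have gE x : g x = pscale x.1 u + pscale x.2 (qmul T' m' (0, 1) u).
  rewrite -gXu -!gZ -raddfD; congr (g _).
  by apply: injective_projections => /=; ring.
have [] : (- m, T) = (- m', T') :> F * F.
  apply: gI; rewrite [RHS]gE.
  have -> : (- m, T) = qmul T m (0, 1) (0, 1) :> F * F.
    by apply: injective_projections => /=; ring.
  by rewrite gX gXu; apply: injective_projections => /=; ring.
move=> /oppr_inj mE TE; split=> // x; rewrite gE TE mE.
by apply: injective_projections => /=; ring.
Qed.

Lemma intertwine_multiplication be be' :
    (forall x, g (qmul T m (0, 1) x) = qmul T' m' (0, 1) (g x)) ->
    (forall x, g (qmul T m be x) = qmul T' m' be' (g x)) ->
  be = be'.
Proof.
move=> /intertwine_generator[TE mE gE] gM; apply: (bij_inj gb).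
by rewrite -[be in LHS](qmul1 T m) gM -TE -mE qmulC -gE.
Qed.

End Isomorphism.

(** Norms and second coordinates tell the three alternatives apart. Within the last one, [c] and
    [c'] are monic associates of norm zero, and such elements coincide. *)
Lemma constant_unique T m d t u c c' :
    qnorm T m u != 0 -> c' = qmul T m u c + qmul T m d t ->
    [\/ c = 0, c = (1, 0) /\ qnorm T m d = 0
        | [/\ d = 0, c.2 = 1 & qnorm T m c = 0]] ->
    [\/ c' = 0, c' = (1, 0) /\ qnorm T m d = 0
        | [/\ d = 0, c'.2 = 1 & qnorm T m c' = 0]] ->
  c = c'.
Proof.
have N0 : qnorm T m 0 = 0 by rewrite /qnorm /=; ring.
have N1 : qnorm T m (1, 0) = 1 by rewrite /qnorm /=; ring.
have M0 x : qmul T m x 0 = 0 by rewrite raddf0.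
have NN x : qnorm T m (- x) = qnorm T m x by rewrite /qnorm /=; ring.
move=> Nu + cn; case: cn => [->|[-> Nd]|[-> c2 Nc]].
- rewrite M0 add0r => c'E [->//|[c'1 Nd]|[d0 c'2 _]].
    have /eqP := qnormM T m d t; rewrite -c'E c'1 N1 Nd mul0r.
    by rewrite oner_eq0.
  by move: c'2; rewrite c'E d0 qmulC M0 /= => /eqP; rewrite eq_sym oner_eq0.
- rewrite qmul1 => c'E [c'0|[->//]|[d0 _ Nc']].
    move: Nu; rewrite c'0 in c'E; have -> : u = - qmul T m d t.
      by apply/eqP; rewrite -addr_eq0 -c'E.
    by rewrite NN qnormM Nd mul0r eqxx.
  by move: Nu; rewrite -Nc' c'E d0 [qmul _ _ 0 t]qmulC M0 addr0 eqxx.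
rewrite [qmul _ _ 0 t]qmulC M0 addr0 => c'E; have Nc' : qnorm T m c' = 0.
  by rewrite c'E qnormM Nc mulr0.
case=> [c'0|[c'1 _]|[_ c'2 _]].
- have /eqP : c = 0 by apply: (bij_inj (qmul_bij Nu)); rewrite -c'E M0.
  by rewrite -pair_eqE /pair_eq /= c2 oner_eq0 andbF.
- by move: Nc'; rewrite c'1 N1 => /eqP; rewrite oner_eq0.
(* [(c.1 + T, - 1)] is the conjugate of [c]. It annihilates [c], hence its multiple [c'], and its
   product with [c'] has second coordinate [c.1 - c'.1]. *)
have /(congr1 snd) : qmul T m (c.1 + T, - 1) c' = 0.
  rewrite c'E qmulCA; have -> : qmul T m (c.1 + T, - 1) c = (qnorm T m c, 0).
    by apply: injective_projections; rewrite /qnorm /= ?c2; ring.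
  by rewrite Nc M0.
rewrite /= c'2 mulr1 mulN1r mulrN1 mulr1 => E.
apply: injective_projections; rewrite ?c2 ?c'2 //.
by apply/eqP; rewrite -subr_eq0 -E; apply/eqP; ring.
Qed.

(** The linear part [g] of an isomorphism conjugates both multiplications. Scalars are preserved, so
    both sides fall under the same alternative; if X occurs, [g] is multiplication by a unit and
    [constant_unique] applies. *)
Lemma qnormal_unique T m al be c T' m' al' be' c' :
    (forall f : {additive (F * F)%type -> (F * F)%type}, plinear f) ->
    qnormal T m al be c -> qnormal T' m' al' be' c' ->
    isomorphic (qop T m al be c) (qop T' m' al' be' c') ->
  (T, m, al, be, c) = (T', m', al', be', c').
Proof.
move=> lin [Nal Nbe gen cn] [Nal' Nbe' gen' cn'] [f [fb fM]].
have [g [fE gal gbe gc]] :=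
  affine_op_isomorphism (qmul_bij Nal) (qmul_bij Nbe) fM.
have gZ := lin g; have gb : bijective g.
  apply: (eq_bij (f := fun x => f x - f 0)) => [|x]; last by rewrite fE addrK.
  have [h fK hK] := fb.
  by exists (fun x => h (x + f 0)) => x; rewrite ?subrK ?fK ?hK ?addrK.
have [alS beS] := (intertwine_scalar gZ gb gal, intertwine_scalar gZ gb gbe).
have XF x : x = (0, 1) -> x.2 <> 0.
  by move=> -> /= /eqP; rewrite oner_eq0.
have conclude : al = al' -> be = be' -> T = T' -> m = m' ->
    (forall x, g x = qmul T m (g (1, 0)) x) ->
    (T, m, al, be, c) = (T', m', al', be', c').
  move=> alE beE TE mE gE; subst T' m' al' be'; congr (_, _).
  apply: (@constant_unique T m ((1, 0) - al - be) (f 0) (g (1, 0))).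
  - apply: qnorm_neq0 => y; rewrite -gE => y0; apply: (bij_inj gb).
    by rewrite y0 raddf0.
  - rewrite -gE; apply: (addrI (qmul T m al (f 0) + qmul T m be (f 0))).
    by rewrite -gc; apply: injective_projections => /=; ring.
  - by case: cn => [|[]|[]] *; [constructor 1|constructor 2|constructor 3].
  by case: cn' => [|[]|[]] *; [constructor 1|constructor 2|constructor 3].
case: gen => [al1|[al2 be1]|[al2 be2 T0 m0]].
- have alE : al = al'.
    by case: gen' => [->|[al2' _]|[al2' _ _ _]] //; apply: alS; right.
  have gX x : g (qmul T m (0, 1) x) = qmul T' m' (0, 1) (g x).
    by have := gal x; rewrite -alE al1.
  have [TE mE gE] := intertwine_generator gZ gb gX.
  by apply: conclude => //; apply: intertwine_multiplication gbe.
- have alE : al = al' by apply: alS; left.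
  have be1' : be' = (0, 1).
    case: gen' => [/XF|[_ ->]|[_ be2' _ _]] //; first by rewrite -alE.
    by rewrite -beS //; right.
  have gX x : g (qmul T m (0, 1) x) = qmul T' m' (0, 1) (g x).
    by have := gbe x; rewrite be1 be1'.
  have [TE mE gE] := intertwine_generator gZ gb gX.
  by apply: conclude; rewrite ?be1 ?be1'.
have alE : al = al' by apply: alS; left.
have beE : be = be' by apply: beS; left.
case: gen' => [/XF|[_ /XF]|[al2' be2' T0' m0']]; rewrite -?alE -?beE //.
(* For two scalars [g] need not be a multiplication, so the constants are compared directly: once
   one of them is [(1, 0)], [d = 0] and [g c = c']. *)
subst al' be' T m T' m'; congr (_, _).
have dE x : (x.2 = 0 :> F) -> x = (x.1, 0) by case: x => ? ? /= ->.
have d2 : ((1, 0) - al - be).2 = 0 by rewrite /= al2 be2 !subr0.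
have Nd0 : qnorm 0 0 ((1, 0) - al - be) = 0 -> (1, 0) - al - be = 0.
  rewrite (dE _ d2) /qnorm /= mulr0 mul0r !addr0 => /eqP.
  by rewrite expf_eq0 /= => /eqP ->.
have gc' : g c + qmul 0 0 ((1, 0) - al - be) (f 0) = c'.
  apply: (addrI (qmul 0 0 al (f 0) + qmul 0 0 be (f 0))).
  by rewrite -gc; apply: injective_projections => /=; ring.
have Z x : qmul 0 0 0 x = 0 by rewrite qmulC raddf0.
case: cn => [c0|[c1 /Nd0 d0]|[/XF]] //; case: cn' => [c0'|[c1' Nd]|[/XF]] //.
- by rewrite c0 c0'.
- move: gc'; rewrite c0 (Nd0 Nd) Z raddf0 addr0 c1' => -[/eqP].
  by rewrite eq_sym oner_eq0.
- move: gc'; rewrite d0 Z addr0 c0' -[0](raddf0 g) => /(bij_inj gb) ->.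
  by rewrite raddf0.
by rewrite c1 c1'.
Qed.

End Classification.

(** * Explicit parametrization of the normal forms *)

Ltac qring := rewrite /qnorm /=; ring.

Section Families.
Variable F : fieldType.
Implicit Types (T m a b r s k l : F) (x al be c : F * F).

Definition qdata : Type := (F * F * (F * F) * (F * F) * (F * F))%type.

Definition qdata_op (D : qdata) : F * F -> F * F -> F * F :=
  let: (T, m, al, be, c) := D in qop T m al be c.

Definition qdata_normal (D : qdata) : Prop :=
  let: (T, m, al, be, c) := D in qnormal T m al be c.

(* In the third and fourth summands r and s are the roots of X^2 - T X + m;
   in the third and sixth, d is a nonzero multiple of X - r, resp. of
   X - (1 - k). *)
Definition index : Type :=
  (F * F * F * F + (F * F + (F * F * F + (F * F +
    (F * F * F + (F * F + (F * F + F)))))))%type.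

Definition family (i : index) : qdata :=
  match i with
  | inl (a, b, m, T) => (T, m, (0, 1), (a, b), 0)
  | inr (inl (m, T)) => (T, m, (0, 1), (1, - 1), (1, 0))
  | inr (inr (inl (r, b, s))) =>
      (r + s, r * s, (0, 1), (1 - (1 + b) * r, b), (1, 0))
  | inr (inr (inr (inl (r, s)))) =>
      (r + s, r * s, (0, 1), (1, - 1), (- s, 1))
  | inr (inr (inr (inr (inl (k, m, T))))) => (T, m, (k, 0), (0, 1), 0)
  | inr (inr (inr (inr (inr (inl (k, s)))))) =>
      (1 - k + s, (1 - k) * s, (k, 0), (0, 1), (1, 0))
  | inr (inr (inr (inr (inr (inr (inl (k, l))))))) =>
      (0, 0, (k, 0), (l, 0), 0)
  | inr (inr (inr (inr (inr (inr (inr k)))))) =>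
      (0, 0, (k, 0), (1 - k, 0), (1, 0))
  end.

(** These conditions make the norms of [al] and [be] nonzero; in terms of the roots, the norm of
    [a + b X] is [(a + b r) (a + b s)]. In the third summand [1 + b != 0] says that [d] is nonzero,
    which separates it from the second. *)
Definition admissible (i : index) : bool :=
  match i with
  | inl (a, b, m, T) => (m != 0) && (qnorm T m (a, b) != 0)
  | inr (inl (m, T)) => (m != 0) && (1 - T + m != 0)
  | inr (inr (inl (r, b, s))) =>
      [&& r != 0, 1 - r != 0, 1 + b != 0, s != 0 & 1 - r + b * (s - r) != 0]
  | inr (inr (inr (inl (r, s)))) => [&& r != 0, 1 - r != 0, s != 0 & 1 - s != 0]
  | inr (inr (inr (inr (inl (k, m, T))))) => (k != 0) && (m != 0)
  | inr (inr (inr (inr (inr (inl (k, s)))))) => [&& k != 0, 1 - k != 0 & s != 0]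
  | inr (inr (inr (inr (inr (inr (inl (k, l))))))) => (k != 0) && (l != 0)
  | inr (inr (inr (inr (inr (inr (inr k)))))) => (k != 0) && (1 - k != 0)
  end.

(** A left inverse of [family] on admissible indices. In the third summand [r] is recovered as the
    root of [d = (1 - be.1) - (1 + be.2) X]. *)
Definition index_of (D : qdata) : index :=
  let: (T, m, al, be, c) := D in
  if al.2 != 0 then
    if c.2 != 0 then inr (inr (inr (inl (T + c.1, - c.1))))
    else if c.1 == 0 then inl (be.1, be.2, m, T)
    else if 1 + be.2 == 0 then inr (inl (m, T))
    else let r := (1 - be.1) / (1 + be.2) in inr (inr (inl (r, be.2, T - r)))
  else if be.2 != 0 then
    if c.1 == 0 then inr (inr (inr (inr (inl (al.1, m, T)))))
    else inr (inr (inr (inr (inr (inl (al.1, T - (1 - al.1)))))))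
  else if c.1 == 0 then inr (inr (inr (inr (inr (inr (inl (al.1, be.1)))))))
  else inr (inr (inr (inr (inr (inr (inr al.1)))))).

Lemma familyK i : admissible i -> index_of (family i) = i.
Proof.
case: i => [[[[a b] m] T]|
  [[m T]|[[[r b] s]|[[r s]|[[[k m] T]|[[k s]|[[k l]|k]]]]]]] /=;
  rewrite ?oner_eq0 ?eqxx //=.
- by rewrite subrr eqxx.
- case/and5P => _ _ b1 _ _; rewrite (negPf b1).
  have -> : (1 - (1 - (1 + b) * r)) / (1 + b) = r by field.
  by congr (inr (inr (inl (_, _)))); qring.
- by move=> _; rewrite opprK addrK.
by move=> _; congr (inr (inr (inr (inr (inr (inl (_, _))))))); qring.
Qed.

Lemma family_normal i : admissible i -> qdata_normal (family i).
Proof.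
case: i => [[[[a b] m] T]|
  [[m T]|[[[r b] s]|[[r s]|[[[k m] T]|[[k s]|[[k l]|k]]]]]]] /=.
- move=> /andP[m0 N]; split=> //; last by constructor 1.
    by rewrite [qnorm _ _ _](_ : _ = m) //; qring.
  by constructor 1.
- move=> /andP[m0 N]; split; last constructor 2.
  + by rewrite [qnorm _ _ _](_ : _ = m) //; qring.
  + by rewrite [qnorm _ _ _](_ : _ = 1 - T + m) //; qring.
  + by constructor 1.
  by split=> //; qring.
- case/and5P=> r0 r1 b1 s0 N; split; last constructor 2.
  + by rewrite [qnorm _ _ _](_ : _ = r * s) ?mulf_neq0 //; qring.
  + rewrite [qnorm _ _ _](_ : _ = (1 - r) * (1 - r + b * (s - r))).
      by rewrite mulf_neq0.
    by qring.
  + by constructor 1.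
  by split=> //; qring.
- case/and4P=> r0 r1 s0 s1; split; last constructor 3.
  + by rewrite [qnorm _ _ _](_ : _ = r * s) ?mulf_neq0 //; qring.
  + by rewrite [qnorm _ _ _](_ : _ = (1 - r) * (1 - s)) ?mulf_neq0 //; qring.
  + by constructor 1.
  split=> //; last by qring.
  by apply: injective_projections => /=; qring.
- move=> /andP[k0 m0]; split=> //; last by constructor 1.
  + by rewrite [qnorm _ _ _](_ : _ = k ^+ 2) ?expf_neq0 //; qring.
  + by rewrite [qnorm _ _ _](_ : _ = m) //; qring.
  by constructor 2.
- case/and3P=> k0 k1 s0; split; last constructor 2.
  + by rewrite [qnorm _ _ _](_ : _ = k ^+ 2) ?expf_neq0 //; qring.
  + by rewrite [qnorm _ _ _](_ : _ = (1 - k) * s) ?mulf_neq0 //; qring.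
  + by constructor 2.
  by split=> //; qring.
- move=> /andP[k0 l0]; split; last by constructor 1.
  + by rewrite [qnorm _ _ _](_ : _ = k ^+ 2) ?expf_neq0 //; qring.
  + by rewrite [qnorm _ _ _](_ : _ = l ^+ 2) ?expf_neq0 //; qring.
  by constructor 3.
move=> /andP[k0 k1]; split; last constructor 2.
+ by rewrite [qnorm _ _ _](_ : _ = k ^+ 2) ?expf_neq0 //; qring.
+ by rewrite [qnorm _ _ _](_ : _ = (1 - k) ^+ 2) ?expf_neq0 //; qring.
+ by constructor 3.
by split=> //; qring.
Qed.

(** A nonzero non-unit [d] is a scalar multiple of some [X - r]; its zero norm says that [r] is a
    root of [X^2 - T X + m], so the other root is [s = T - r]. *)
Lemma normal_family D :
  qdata_normal D -> exists2 i, admissible i & family i = D.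
Proof.
case: D => [[[[T m] [al1 al2]] [a b]] [c1 c2]] /= [Nal Nbe].
case=> [[E1 E2]|[/= E [E1 E2]]|[/= E1 E2 E3 E4]]; subst.
- have {Nal}m0 : m != 0.
    by move: Nal; rewrite [qnorm _ _ _](_ : _ = m) //; qring.
  case=> [[-> ->]|[[-> ->] Nd]|[_ [a1 b1] /= -> Nc]].
  + by exists (inl (a, b, m, T)); rewrite //= m0.
  + have [b1|b1] := eqVneq (1 + b) 0.
      have bE : b = - 1 by apply/eqP; rewrite -addr_eq0 addrC b1.
      have aE : a = 1.
        move: Nd; rewrite bE [qnorm _ _ _](_ : _ = (1 - a) ^+ 2); last by qring.
        by move/eqP; rewrite expf_eq0 /= subr_eq0 => /eqP.
      exists (inr (inl (m, T))); rewrite /= ?bE ?aE //.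
      rewrite m0; move: Nbe; rewrite aE bE.
      by rewrite [qnorm _ _ _](_ : _ = 1 - T + m) //; qring.
    pose r := (1 - a) / (1 + b); pose s := T - r.
    have aE : a = 1 - (1 + b) * r by rewrite /r; field.
    have TE : T = r + s by rewrite /s; qring.
    have mE : m = r * s.
      move: Nd; rewrite TE aE.
      rewrite [qnorm _ _ _](_ : _ = (1 + b) ^+ 2 * (m - r * s)); last by qring.
      by move/eqP; rewrite mulf_eq0 expf_eq0 /= (negPf b1) subr_eq0 => /eqP.
    exists (inr (inr (inl (r, b, s)))); last by rewrite /= -TE -mE -aE.
    rewrite /= b1 /=; move: m0 Nbe.
    rewrite mE mulf_eq0 negb_or => /andP[-> ->] /=.
    rewrite TE aE [qnorm _ _ _](_ : _ = (1 - r) * (1 - r + b * (s - r))).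
      by rewrite mulf_eq0 negb_or.
    by qring.
  have aE : a = 1 by rewrite -[a]addr0 -a1; ring.
  have bE : b = - 1 by rewrite -[b]addr0 -b1; ring.
  (* Since [c = X - s] has norm zero, [s] is a root and [r] is the other one. *)
  pose s := - c1; pose r := T - s.
  have c1E : c1 = - s by rewrite opprK.
  have TE : T = r + s by rewrite /r; qring.
  have mE : m = r * s.
    move: Nc; rewrite TE c1E [qnorm _ _ _](_ : _ = m - r * s); last by qring.
    by move/eqP; rewrite subr_eq0 => /eqP.
  exists (inr (inr (inr (inl (r, s))))); last by rewrite /= -TE -mE -c1E aE bE.
  move: m0 Nbe; rewrite /= mE mulf_eq0 negb_or => /andP[-> ->].
  rewrite TE aE bE [qnorm _ _ _](_ : _ = (1 - r) * (1 - s)); last by qring.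
  by rewrite mulf_eq0 negb_or => /andP[-> ->].
- have {Nal}k0 : al1 != 0.
    move: Nal; rewrite [qnorm _ _ _](_ : _ = al1 ^+ 2); last by qring.
    by rewrite expf_eq0.
  have {Nbe}m0 : m != 0.
    by move: Nbe; rewrite [qnorm _ _ _](_ : _ = m) //; qring.
  case=> [[-> ->]|[[-> ->] Nd]|[[_ /eqP]]]; last by rewrite eq_sym oner_eq0.
    by exists (inr (inr (inr (inr (inl (al1, m, T)))))); rewrite //= k0.
  pose s := T - (1 - al1); have TE : T = 1 - al1 + s by rewrite /s; qring.
  have mE : m = (1 - al1) * s.
    move: Nd; rewrite TE.
    rewrite [qnorm _ _ _](_ : _ = m - (1 - al1) * s); last by qring.
    by move/eqP; rewrite subr_eq0 => /eqP.
  exists (inr (inr (inr (inr (inr (inl (al1, s)))))));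
    last by rewrite /= -TE -mE.
  by move: m0; rewrite /= k0 mE mulf_eq0 negb_or.
have NE k : qnorm 0 0 (k, 0) = k ^+ 2 by qring.
move: Nal Nbe; rewrite !NE !expf_eq0 /= => k0 l0.
case=> [[-> ->]|[[-> ->] Nd]|[[_ /eqP]]]; last by rewrite eq_sym oner_eq0.
  by exists (inr (inr (inr (inr (inr (inr (inl (al1, a)))))))); rewrite //= k0.
have aE : a = 1 - al1.
  move: Nd; rewrite [qnorm _ _ _](_ : _ = (1 - al1 - a) ^+ 2); last by qring.
  by move/eqP; rewrite expf_eq0 /= subr_eq0 => /eqP.
exists (inr (inr (inr (inr (inr (inr (inr al1))))))); last by rewrite /= aE.
by rewrite /= k0 -aE.
Qed.

End Families.

(** * Counting the admissible parameters *)

Section Counting.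
Variable F : finFieldType.

Lemma sum_pair (A B : finType) (f : A * B -> nat) :
  (\sum_x f x = \sum_a \sum_b f (a, b))%N.
Proof. by rewrite pair_bigA; apply: eq_bigr => -[]. Qed.

(** The counts below are iterated sums over the field of functions that are constant off at most
    three exceptional points. *)
Lemma sum_generic_value (A : finType) (s : seq A) (f : A -> nat) (v : nat) :
    uniq s -> (forall x, x \notin s -> f x = v) ->
  (\sum_x f x = \sum_(x <- s) f x + (#|A| - size s) * v)%N.
Proof.
move=> us fv; rewrite (bigID (mem s)) /= big_uniq //; congr (_ + _)%N.
rewrite (eq_bigr (fun=> v)) // sum_nat_const -(card_uniqP us) -(cardC (mem s)).
by rewrite addKn; congr (_ * _)%N; apply: eq_card => x; rewrite !inE.
Qed.

Lemma sum_generic1 (a : F) (f : F -> nat) (v : nat) :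
  (forall x, x != a -> f x = v) -> (\sum_x f x = f a + #|F|.-1 * v)%N.
Proof.
move=> fv; rewrite (@sum_generic_value _ [:: a] _ v) ?big_seq1 ?subn1 //.
by move=> x; rewrite inE => /fv.
Qed.

Lemma sum_generic2 (a b : F) (f : F -> nat) (v : nat) :
    a != b -> (forall x, x != a -> x != b -> f x = v) ->
  (\sum_x f x = f a + f b + (#|F| - 2) * v)%N.
Proof.
move=> ab fv; rewrite (@sum_generic_value _ [:: a; b] _ v) //=.
- by rewrite !big_cons big_nil addn0.
- by rewrite inE ab.
by move=> x; rewrite !inE negb_or => /andP[]; apply: fv.
Qed.

Lemma sum_generic3 (a b c : F) (f : F -> nat) (v : nat) :
    a != b -> a != c -> b != c ->
    (forall x, x != a -> x != b -> x != c -> f x = v) ->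
  (\sum_x f x = f a + f b + f c + (#|F| - 3) * v)%N.
Proof.
move=> ab ac bc fv; rewrite (@sum_generic_value _ [:: a; b; c] _ v) //=.
- by rewrite !big_cons big_nil addn0 !addnA.
- by rewrite !inE negb_or ab ac bc.
by move=> x; rewrite !inE !negb_or => /and3P[]; apply: fv.
Qed.

Lemma sum_affine_neq0 (u v : F) :
  v != 0 -> (\sum_(x : F) (u + v * x != 0)%R = #|F|.-1)%N.
Proof.
move=> v0; rewrite (sum_generic1 (a := - u / v) (v := 1)).
  by rewrite (_ : u + _ = 0) ?eqxx ?muln1 //; field.
move=> x xn; rewrite (_ : u + _ = v * (x - - u / v)); last by field.
by rewrite mulf_neq0 ?subr_eq0.
Qed.

Lemma count_cyclic_constant0 :
  (\sum_(i : F * F * F * F)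
     admissible (inl i : index F) =
   #|F|.-1 * (#|F|.-1 * #|F| + #|F|.-1 * (#|F| + #|F|.-1 * #|F|.-1)))%N.
Proof.
have inner (a b m : F) :
  (\sum_T ((m != 0) && (qnorm T m (a, b) != 0))%R =
   (m != 0)%R * (if a == 0%R then if b == 0%R then 0 else #|F|
               else if b == 0%R then #|F| else #|F|.-1))%N.
  have [m0|m0] := eqVneq m 0; first by rewrite big1.
  (* For fixed [a], [b], [m] the norm is affine in [T] with slope [a * b], hence constant in [T] if
     [a] or [b] vanishes. *)
  rewrite mul1n; under eq_bigr => T _.
    rewrite [qnorm _ _ _](_ : _ = a ^+ 2 + m * b ^+ 2 + a * b * T); last first.
      by qring.
    over.
  have [a0|a0] := eqVneq a 0; have [b0|b0] := eqVneq b 0; rewrite /=.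
  - by rewrite big1 // a0 b0 => T _; rewrite expr0n /= mulr0 !mul0r !addr0 eqxx.
  - rewrite (eq_bigr (fun=> 1%N)) ?sum1_card // => T _.
    by rewrite a0 expr0n /= add0r !mul0r addr0 mulf_neq0 ?expf_neq0.
  - rewrite (eq_bigr (fun=> 1%N)) ?sum1_card // => T _.
    by rewrite b0 expr0n /= !mulr0 mul0r !addr0 expf_neq0.
  by rewrite sum_affine_neq0 // mulf_neq0.
have outer (v : nat) : (\sum_(m : F) (m != 0)%R * v = #|F|.-1 * v)%N.
  rewrite (sum_generic1 (a := 0) (v := v)) ?eqxx //.
  by move=> x ->; rewrite mul1n.
rewrite 3!sum_pair /=.
under eq_bigr => a _.
  under eq_bigr => b _.
    under eq_bigr => m _ do rewrite inner.
    rewrite outer //; over.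
  over.
rewrite (sum_generic1 (a := 0)
  (v := (#|F|.-1 * (#|F| + #|F|.-1 * #|F|.-1))%N)).
  rewrite (sum_generic1 (a := 0) (v := (#|F|.-1 * #|F|)%N)) ?eqxx ?muln0 //.
    by ring.
  by move=> b /negPf ->.
move=> a /negPf ->.
rewrite (sum_generic1 (a := 0) (v := (#|F|.-1 * #|F|.-1)%N)) ?eqxx //.
  by ring.
by move=> b /negPf ->.
Qed.

Lemma count_neq0 : (\sum_(x : F) (x != 0%R) = #|F|.-1)%N.
Proof. by rewrite (sum_generic1 (a := 0) (v := 1)) ?eqxx ?muln1 // => x ->. Qed.

Lemma count_neq01 : (\sum_(x : F) ((x != 0) && (1 - x != 0))%R = #|F| - 2)%N.
Proof.
rewrite (sum_generic2 (a := 0) (b := 1) (v := 1)).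
- by rewrite subrr !eqxx andbF muln1.
- by rewrite eq_sym oner_eq0.
by move=> x -> x1; rewrite subr_eq0 eq_sym x1.
Qed.

Lemma count_cyclic_d0_constant1 :
  (\sum_(i : F * F) admissible (inr (inl i) : index F) =
   #|F|.-1 * #|F|.-1)%N.
Proof.
rewrite sum_pair (sum_generic1 (a := 0) (v := #|F|.-1)) /=.
  by rewrite eqxx big1.
move=> m ->; rewrite -(@sum_affine_neq0 (1 + m) (- 1)) ?oppr_eq0 ?oner_eq0 //.
by apply: eq_bigr => T _; congr (nat_of_bool (_ != _)); ring.
Qed.

Lemma count_cyclic_singular_constant1 :
  (\sum_(i : F * F * F) admissible (inr (inr (inl i)) : index F) =
   (#|F| - 2) * (#|F|.-1 + #|F|.-1 + (#|F| - 3) * (#|F| - 2)))%N.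
Proof.
rewrite !sum_pair (sum_generic2 (a := 0) (b := 1)
  (v := (#|F|.-1 + #|F|.-1 + (#|F| - 3) * (#|F| - 2))%N)) /=.
- by rewrite !big1 => [//|b _|b _]; apply: big1 => s _;
    rewrite ?subrr ?eqxx ?andbF.
- by rewrite eq_sym oner_eq0.
move=> r r0 r1; rewrite r0 subr_eq0 eq_sym r1 /=.
have r1' : 1 - r != 0 by rewrite subr_eq0 eq_sym.
(* The value [b = - 1] is excluded. For [b = 0] the last factor is the constant [1 - r], and for
   [b = (1 - r) / r] it is a nonzero multiple of [s]; both leave only [s != 0]. *)
rewrite (sum_generic3 (a := - 1) (b := 0) (c := (1 - r) / r)
  (v := (#|F| - 2)%N)).
- rewrite subrr addr0 eqxx oner_eq0 /= big1 // add0n; congr (_ + _ + _)%N.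
    rewrite -count_neq0; apply: eq_bigr => s _.
    by rewrite mul0r addr0 r1' andbT.
  rewrite -count_neq0; apply: eq_bigr => s _.
  have -> : 1 + (1 - r) / r = r^-1 by field.
  have -> : 1 - r + (1 - r) / r * (s - r) = (1 - r) / r * s by field.
  by rewrite invr_eq0 r0 !mulf_eq0 invr_eq0 (negPf r0) (negPf r1') /= andbb.
- by rewrite oppr_eq0 oner_eq0.
- rewrite eq_sym -subr_eq0 (_ : _ - _ = r^-1); last by field.
  by rewrite invr_eq0.
- by rewrite eq_sym mulf_neq0 ?invr_eq0.
move=> b b1 b0 br; have b1' : 1 + b != 0 by rewrite addrC addr_eq0.
(* [s0] is the zero of the last factor in [s]; it differs from 0 because [b] is not
   [(1 - r) / r]. *)
pose s0 := ((1 + b) * r - 1) / b.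
rewrite b1' /= (sum_generic2 (a := 0) (b := s0) (v := 1)).
- rewrite eqxx /= (_ : 1 - r + _ = 0) ?eqxx ?andbF ?muln1 //.
  by rewrite /s0; field.
- rewrite eq_sym mulf_neq0 ?invr_eq0 //; apply: contraNneq br => E.
  by apply/eqP; have -> : 1 - r = b * r; [rewrite -[LHS]addr0 -E; ring|field].
move=> s -> ss0 /=; rewrite (_ : 1 - r + _ = b * (s - s0)).
  by rewrite mulf_neq0 ?subr_eq0.
by rewrite /s0; field.
Qed.

Lemma card_admissible :
  #|[set i : index F | admissible i]| =
    (#|F| ^ 4 - #|F| ^ 2 - #|F| - 1)%N.
Proof.
rewrite -sum1dep_card big_mkcond /=.
have E (b : bool) : (if b then 1 else 0)%N = b by case: b.
under eq_bigr => i _ do rewrite E.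
rewrite !big_sumType /=.
have c4 : (\sum_(i : F * F)
    admissible (inr (inr (inr (inl i))) : index F) =
    (#|F| - 2) * (#|F| - 2))%N.
  rewrite sum_pair -{1}count_neq01 big_distrl /=; apply: eq_bigr => r _.
  rewrite -count_neq01 big_distrr /=; apply: eq_bigr => s _.
  by rewrite mulnb -andbA.
have c5 : (\sum_(i : F * F * F)
    admissible (inr (inr (inr (inr (inl i)))) : index F) =
    #|F|.-1 * (#|F|.-1 * #|F|))%N.
  rewrite !sum_pair -{1}count_neq0 big_distrl /=; apply: eq_bigr => k _.
  rewrite -count_neq0 big_distrl big_distrr /=; apply: eq_bigr => m _.
  by rewrite sum_nat_const mulnA mulnb mulnC.
have c6 : (\sum_(i : F * F)
    admissible (inr (inr (inr (inr (inr (inl i))))) : index F) =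
    (#|F| - 2) * #|F|.-1)%N.
  rewrite sum_pair -count_neq01 big_distrl /=; apply: eq_bigr => r _.
  rewrite -count_neq0 big_distrr /=; apply: eq_bigr => s _.
  by rewrite mulnb andbA.
have c7 : (\sum_(i : F * F)
    admissible (inr (inr (inr (inr (inr (inr (inl i)))))) : index F) =
    #|F|.-1 * #|F|.-1)%N.
  rewrite sum_pair -{1}count_neq0 big_distrl /=; apply: eq_bigr => r _.
  rewrite -count_neq0 big_distrr /=; apply: eq_bigr => s _.
  by rewrite mulnb.
rewrite count_cyclic_constant0 count_cyclic_d0_constant1.
rewrite count_cyclic_singular_constant1 c4 c5 c6 c7 count_neq01.
have : (1 < #|F|)%N.
  by apply/card_gt1P; exists (0 : F), (1 : F); rewrite // eq_sym oner_eq0.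
(* Two elements, where [#|F| - 3] truncates, are settled by computation; from three on, writing
   [n.+3] makes the subtractions exact. *)
case: #|F| => [|[|[|n]]] // _.
have -> : (n.+3 - 2 = n.+1)%N by rewrite subSS subn1.
have -> : (n.+3 - 3 = n)%N by rewrite !subSS subn0.
rewrite [n.+3.-1]/=.
rewrite -!subnDA; apply: (canRL (addnK _)).
ring.
Qed.

End Counting.

(** * Conclusion for the plane over a prime field *)

(** The admissible members of [family] form a transversal: [qnormal_unique] and [familyK] separate
    them, while [affine_op_qnormal] and [normal_family] reach every class. *)
Lemma mq_square (F : finFieldType) :
    (forall f : {additive (F * F)%type -> (F * F)%type}, plinear f) ->
  mq (F * F)%type = (#|F| ^ 4 - #|F| ^ 2 - #|F| - 1)%N.
Proof.
move=> lin; rewrite -card_admissible.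
pose op (i : index F) : binop (F * F)%type :=
  [ffun xy => qdata_op (family i) xy.1 xy.2].
have opE i : binop_fun (op i) = qdata_op (family i).
  by apply: funext => x; apply: funext => y; rewrite /binop_fun ffunE.
apply: (card_equivalence_partition (f := op)).
- move=> s t u; split; first exact/asboolP/isomorphic_refl.
  move=> /asboolP st; apply/asboolP/asboolP; apply: isomorphic_trans => //.
  exact: isomorphic_sym.
- move=> i; rewrite !inE opE => /family_normal.
  case: (family i) => [[[[T m] al] be] c] [Nal Nbe _ _].
  by apply/andP; split; apply/asboolP;
    [apply: qop_medial_quasigroup|apply: qop_admits_affine_form].
- move=> i j; rewrite !inE => iA jA /asboolP; rewrite !opE => iso.
  rewrite -(familyK iA) -(familyK jA); congr index_of; move: iso.
  move: (family_normal iA) (family_normal jA).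
  case: (family i) (family j) => [[[[? ?] ?] ?] ?] [[[[? ?] ?] ?] ?].
  exact: qnormal_unique.
move=> t; rewrite inE => /andP[/asboolP mt /asboolP].
move=> [phi [psi [c [phib psib iso]]]].
have [_ /medial_affine_op comm] := medial_quasigroup_iso iso mt.
have [T [m [al [be [c' [N iso']]]]]] :=
  affine_op_qnormal c (lin phi) (lin psi) phib psib comm.
have [i iA iE] := @normal_family _ (T, m, al, be, c') N.
exists i; first by rewrite inE.
by apply/asboolP; rewrite opE iE; apply: isomorphic_trans iso iso'.
Qed.

(** Every scalar is a natural multiple of 1, and additive maps respect such multiples. *)
Lemma Fp_additive_plinear (p : nat)
    (f : {additive ('F_p * 'F_p)%type -> ('F_p * 'F_p)%type}) : plinear f.
Proof.
have nE n x : pscale (n%:R : 'F_p) x = x *+ n.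
  elim: n => [|n IHn]; first by apply: injective_projections; rewrite /= mul0r.
  rewrite [RHS]mulrS -IHn; apply: injective_projections;
  by rewrite /= mulrS mulrDl mul1r.
by move=> k x; rewrite -[k]natr_Zp !nE raddfMn.
Qed.

Theorem theorem1p1 (p : nat) (p_prime : prime p) :
  mq ('Z_p * 'Z_p)%type = (p ^ 4 - p ^ 2 - p - 1)%N.
Proof.
(* ['F_p] stands for ['Z_(pdiv p)], and [pdiv p = p] for prime [p]. *)
have : mq ('Z_(pdiv p) * 'Z_(pdiv p))%type = (p ^ 4 - p ^ 2 - p - 1)%N.
  have := @mq_square 'F_p (@Fp_additive_plinear p).
  by rewrite card_Fp.
by rewrite pdiv_id.
Qed.
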